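(* Let $R_q(1,m)$ be the first-order Generalized Reed-Muller code of length $q^m$ ($m\in\mathbb N$, $q$ a power of a prime number). If $n=q^m-1=r_1\cdot r_2$ with $\gcd(r_1,r_2)=1$ and $r_1,r_2>1$, then we can correct up to $s$ errors by using Algorithm I with respect to the information set $$I=\{0\}\cup\{\alpha^i \mid i\in\varphi^{-1}(\Gamma)\},\qquad \Gamma=\{(i_1,i_2)\in\mathbb Z_{r_1}\times\mathbb Z_{r_2} \mid 0\le i_1<m,\ 0\le i_2<1\},$$ where $$s=(\lambda_0+1)\cdot r_2-1\qquad\text{and}\qquad \lambda_0=\max\left\{\lambda \;\middle|\; m<\left\lceil \frac{r_1}{\lambda}\right\rceil\right\}$$ ($\lambda$ ranging over positive integers).
   Context: Setting. $\mathbb K$ is the field with $q$ elements, $F\supseteq\mathbb K$ is the field with $q^m$ elements, $G$ is the additive group of $F$, $n=q^m-1$, $G^*=G\setminus\{0\}$, and $\alpha$ is a fixed generator of the cyclic multiplicative group $G^*$. The ambient space is the group algebra $\mathbb K G$, whose elements are written $bX^0+\sum_{i=0}^{n-1}a_iX^{\alpha^i}$ with $b,a_i\in\mathbb K$; positions are indexed by $G=\{0,\alpha^0,\dots,\alpha^{n-1}\}$. $\varphi:\mathbb Z_n\to\mathbb Z_{r_1}\times\mathbb Z_{r_2}$ is a fixed arbitrary isomorphism; elements of $\mathbb Z_r$ are represented by $0,\dots,r-1$. The code. For $0\le j\le n$ let $\phi_j:\mathbb K G\to F$ be $\phi_j\big(bX^0+\sum_i a_iX^{\alpha^i}\big)=b\,0^j+\sum_{i}a_i\alpha^{ij}$,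 with $0^0=1$. For $k\in\mathbb N$ with $q$-ary expansion $k=\sum_r k_rq^r$ ($0\le k_r\le q-1$), its $q$-weight is $\mathrm{wt}_q(k)=\sum_r k_r$. The first-order GRM code $R_q(1,m)$ is the set of all $x\in\mathbb K G$ with $\phi_j(x)=0$ for every $0\le j<q^m-1$ with $\mathrm{wt}_q(j)<m(q-1)-1$. It has dimension $m+1$ and minimum distance $q^{m-1}(q-1)$. It is affine-invariant, i.e. it is an extended cyclic code preserved by all maps $x\mapsto ax+b$ of $G$ with $a\in G^*$, $b\in G$. Write $\mathcal C=R_q(1,m)$, let $t$ be its error correction capability, and let $\mathcal C^*$ be the cyclic code obtained by puncturing $\mathcal C$ at the position $X^0$. Information sets. A set $I\subseteq G$ is an information set for a code $\mathcal C$ of dimension $k$ if $|I|=k$ and the projections of the codewords onto the positions in $I$ give all of $\mathbb K^{|I|}$. Put $I'=I$ if $0\notin I$ and $I'=I\setminus\{0\}$ otherwise. $\omega$ denotes Hamming weight. Permutations. A permutation $\tau$ of $G$ acts on $\mathbb K G$ by $\tau\big(\sum_{g\in G}a_gX^g\big)=\sum_{g\in G}a_gX^{\tau(g)}$. $\mathrm{PAut}(\mathcal C)$ is the group of permutations $\tau$ of $G$ with $\tau(\mathcal C)=\mathcal C$; $\mathrm{PAut}(\mathcal C^* )$ is defined in the same way with permutations of $G^*$, and is regarded as a subset of $\mathrm{PAut}(\mathcal C)$ by letting its elements fix $0$. For $J\subseteq G^*$, a set $P\subseteq\mathrm{PAut}(\mathcal C^* )$ is an $s$-PD-like set with respect to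 $J$ if any $s$ positions in $G^*$ are moved out of $J$ by at least one element of $P$. For $0\le k\le n-1$, $\sigma_k$ is the translation $g\mapsto g+\alpha^k$ of $G$, and $\Sigma$ is the sequence $(1_G,\sigma_0,\dots,\sigma_{n-1})$, with $1_G$ the identity. Algorithm I. Let $r=c+e$ be the received word, with $c\in\mathcal C$ and $e$ the error vector, where it is assumed that $\omega(e)\le t$; fix an information set $I$ for $\mathcal C$. (1) Let $H$ be a parity check matrix of $\mathcal C$ in standard form with respect to $I$, and $P\subseteq\mathrm{PAut}(\mathcal C^* )\subseteq\mathrm{PAut}(\mathcal C)$ an $s$-PD-like set ($s\le t$) with respect to $I'$. (2) Start with $r=1_G(r)$. For each $\tau\in P$ compute $\tau(r)$. If some $\tau_0\in P$ satisfies $\omega(H\cdot\tau_0(r)^T)\le t$, then the information symbols of $\tau_0(r)$ are correct; go to (4). If there is no such $\tau_0$, go to (3). (3) Compute $\sigma_i(r)$, where $\sigma_i$ is the next element of $\Sigma$, and repeat (2) starting with $\sigma_i(r)$ instead of $r$. (4) Recover $c'\in\mathcal C$ from the information symbols found (those of $\tau_0(\sigma_i(r))$). (5) Decode to $(\tau_0\circ\sigma_i)^{-1}(c')=c$.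
   Formalization: I need not be an information set (q=2, m=6, r1=7, r2=9): this is proved when q has order m modulo r1, and correction is proved whenever I is an information set, for errors of weight at most s and at most t, as Algorithm I assumes (s can exceed t). *)

(* Defs.v *)
From HB Require Import structures.
From mathcomp Require Export all_boot all_order all_algebra.
From mathcomp Require Export all_fingroup all_solvable.
Set Implicit Arguments.
Unset Strict Implicit.
Unset Printing Implicit Defensive.
Import GRing.Theory.
Local Open Scope ring_scope.

(* Words over K with positions in a finite type T; a linear code is a
   {vspace word K T}.  The element \sum_g a_g X^g of the group algebra of the
   additive group of F is the word g |-> a_g of type [word K F]. *)
Notation word K T := {ffun T -> K^o}.

Section Codes.
Variables (K : finFieldType) (T : finType).
Implicit Types (C : {vspace word K T}) (x : word K T) (I : {set T}).

Definition weight x : nat := #|[set g | x g != 0]|.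

(* The initial value #|T| bounds every weight, hence is irrelevant as soon as
   C has two codewords. *)
Definition min_dist C : nat :=
  \big[minn/#|T|]_(p : word K T * word K T |
     [&& p.1 \in C, p.2 \in C & p.1 != p.2]) weight (p.1 - p.2).

Definition error_capability C : nat := (min_dist C).-1./2.

Definition information_set C I : Prop :=
  #|I| = \dim C /\
  forall a : {ffun T -> K}, exists2 c, c \in C & {in I, forall g, c g = a g}.

(* tau (\sum_g a_g X^g) = \sum_g a_g X^(tau g). *)
Definition perm_word (tau : {perm T}) x : word K T :=
  [ffun h => x ((tau^-1)%g h)].

Definition PAut C : {set {perm T}} :=
  [set tau | [set perm_word tau x | x in C] == [set x in C]].

Definition row_of_word x : 'rV[K]_#|T| := \row_j x (enum_val j).

Definition syndrome r (H : 'M[K]_(r, #|T|)) x : 'cV[K]_r :=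
  H *m (row_of_word x)^T.

Definition cweight r (v : 'cV[K]_r) : nat := #|[set i | v i 0 != 0]|.

(* Parity check matrix whose columns outside I form an identity matrix, the
   positions outside I being listed in some order f. *)
Definition std_parity_check C I r (H : 'M[K]_(r, #|T|)) : Prop :=
  (forall x, (x \in C) = (syndrome H x == 0)) /\
  exists f : 'I_r -> T,
    [/\ injective f, [set f j | j : 'I_r] = ~: I &
        forall i j, H i (enum_rank (f j)) = (i == j)%:R].

Definition codeword_from C I x : option (word K T) :=
  [pick c in C | [forall g in I, c g == x g]].

End Codes.

(* {unit F} is the type of nonzero elements of the field F, i.e. the set of
   positions G^* of the punctured code. *)
Section Puncture.
Variables (K F : finFieldType).

Definition restr (x : word K F) : word K {unit F} :=
  [ffun u : {unit F} => x (val u)].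

Lemma restr_is_linear : linear restr.
Proof. by move=> a x y; apply/ffunP=> u; rewrite !ffunE. Qed.

HB.instance Definition _ := GRing.isLinear.Build K (word K F)
  (word K {unit F}) _ restr restr_is_linear.

Definition puncture (C : {vspace word K F}) : {vspace word K {unit F}} :=
  (linfun restr @: C)%VS.

Lemma mem_puncture (C : {vspace word K F}) u :
  reflect (exists2 x, x \in C & u = restr x) (u \in puncture C).
Proof.
apply: (iffP memv_imgP) => -[x xC ->]; exists x; rewrite ?lfunE //.
Qed.

End Puncture.

Section Permutations.
Variable F : finFieldType.

Definition ext0_fun (tau : {perm {unit F}}) (g : F) : F :=
  if insub g is Some u then val (tau u) else 0.

Lemma ext0_inj tau : injective (ext0_fun tau).
Proof.
have nz (u : {unit F}) : val u != 0.
  by rewrite -unitfE; exact: (valP u).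
have z (g : F) : g \isn't a GRing.unit -> g = 0.
  by rewrite unitfE negbK => /eqP.
move=> g h; rewrite /ext0_fun.
case: insubP => [u _ <-|/z ->]; case: insubP => [v _ <-|/z ->] //.
- by move/val_inj/perm_inj->.
- by move=> e; move: (nz (tau u)); rewrite e eqxx.
- by move=> e; move: (nz (tau v)); rewrite -e eqxx.
Qed.

(* The extension of a permutation of G^* to G that fixes 0. *)
Definition ext0 (tau : {perm {unit F}}) : {perm F} := perm (@ext0_inj tau).

Definition translation (a : F) : {perm F} := perm (@addIr F a).

Definition Sigma (alpha : {unit F}) : seq {perm F} :=
  1%g :: [seq translation (val alpha ^+ k) | k <- iota 0 #|F|.-1].

Definition PD_like (s : nat) (J : {set {unit F}}) (P : {set {perm {unit F}}}) :
    Prop :=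
  forall E : {set {unit F}}, #|E| = s ->
    exists2 tau, tau \in P & [disjoint [set tau u | u in E] & J].

(* I \ {0} as a subset of G^*. *)
Definition nonzero_part (I : {set F}) : {set {unit F}} :=
  [set u : {unit F} | val u \in I].

End Permutations.

Section AlgorithmI.
Variables (K F : finFieldType) (C : {vspace word K F}) (I : {set F}).
Variables (r : nat) (H : 'M[K]_(r, #|F|)).

(* Step (2): the first tau0 in the enumeration P that passes the test on y. *)
Definition find_tau0 (P : seq {perm {unit F}}) (y : word K F) :
    option {perm {unit F}} :=
  ohead [seq tau <- P | (cweight (syndrome H (perm_word (ext0 tau) y))
                           <= error_capability C)%N].

(* Steps (2)-(5) on the received word x, along the list S of translations;
   None means failure.  Recall that (s * t)%g is "s, then t". *)
Fixpoint algorithmI_along (P : seq {perm {unit F}}) (S : seq {perm F})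
    (x : word K F) : option (word K F) :=
  if S is sigma :: S' then
    if find_tau0 P (perm_word sigma x) is Some tau0 then
      let y := perm_word (ext0 tau0) (perm_word sigma x) in
      omap (perm_word ((sigma * ext0 tau0)^-1)%g) (codeword_from C I y)
    else algorithmI_along P S' x
  else None.

Definition algorithmI (alpha : {unit F}) (P : seq {perm {unit F}}) x :=
  algorithmI_along P (Sigma alpha) x.

End AlgorithmI.

(* The sum of the q-ary digits of k; for 1 < q the digits of index > k are 0. *)
Definition wtq (q k : nat) : nat := (\sum_(i < k.+1) (k %/ q ^ i) %% q)%N.

Section GRM.
Variables (K F : finFieldType) (emb : {rmorphism K -> F}).

(* With 0 ^+ 0 = 1 this is b 0^j + \sum_i a_i alpha^(i j), the sum being taken
   over all g in F instead of over 0 and the powers of alpha. *)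
Definition phi_ (j : nat) (x : word K F) : F := \sum_(g : F) emb (x g) * g ^+ j.

Definition GRM1_pred (m : nat) : pred (word K F) := fun x =>
  [forall j : 'I_(#|K| ^ m - 1),
     (wtq #|K| j < m * (#|K| - 1) - 1)%N ==> (phi_ j x == 0)].

Definition GRM1 (m : nat) : {vspace word K F} :=
  <<enum (GRM1_pred m)>>%VS.

Lemma mem_GRM1 m x : (x \in GRM1 m) = GRM1_pred m x.
Proof.
have phiD j a y z : phi_ j (a *: y + z) = emb a * phi_ j y + phi_ j z.
  rewrite /phi_ mulr_sumr -big_split; apply: eq_bigr => g _ /=.
  by rewrite !ffunE rmorphD rmorphM mulrDl mulrA.
have phi0 j : phi_ j 0 = 0.
  by rewrite /phi_ big1 // => g _; rewrite ffunE rmorph0 mul0r.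
apply/idP/idP => [|px]; last first.
  by apply: memv_span; rewrite mem_enum.
rewrite /GRM1; set X := enum _.
move=> /(@coord_span _ _ _ (in_tuple X)) ->.
apply/forallP => j; apply/implyP => wj.
elim/big_ind: _ => [|y z /eqP y0 /eqP z0|i _]; first by rewrite phi0.
- by rewrite -[y]scale1r phiD y0 z0 mulr0 addr0.
- rewrite -[_ *: _]addr0 phiD phi0 addr0.
  have: X`_i \in X by rewrite mem_nth.
  rewrite mem_enum => /forallP/(_ j)/implyP/(_ wj)/eqP ->.
  by rewrite mulr0.
Qed.

End GRM.

Section InfoSet.
Variables (F : finFieldType) (alpha : {unit F}) (m n r1 r2 : nat).
Variable phi : {additive 'Z_n -> 'Z_r1 * 'Z_r2}.

Definition Gamma : {set 'Z_r1 * 'Z_r2} :=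
  [set p : 'Z_r1 * 'Z_r2 | (p.1 < m)%N && (p.2 < 1)%N].

Definition GammaInfoSet : {set F} :=
  0 |: [set val alpha ^+ i | i : 'Z_n in phi @^-1: Gamma].

End InfoSet.

Definition is_lambda0 (m r1 lambda0 : nat) : Prop :=
  let ok l := (0 < l)%N /\ (m%:Z < Num.ceil (r1%:Q / l%:Q))%R in
  ok lambda0 /\ forall l, ok l -> (l <= lambda0)%N.

(* Main.v *)
Require Import Defs.
From mathcomp Require Import all_field zify.
Set Implicit Arguments.
Unset Strict Implicit.
Unset Printing Implicit Defensive.
Import GRing.Theory.
Local Open Scope ring_scope.

(* Interpolation shows that R_q(1,m) consists of the K-valued functions
   c_0 + \sum_(i < m) c_i g^(q^i) on F; hence it is invariant under
   translations and under multiplication by units.  With beta of order r1 the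
   information set is {0, 1, beta, ..., beta^(m-1)}; vanishing there forces the
   c_i to vanish by a Vandermonde argument in the nodes beta^(q^i), and the trace
   functions supply enough codewords.
     Identify G^* with Z_r1 x Z_r2.  Among s < (lambda0 + 1) r2 positions some
   column Z_r1 x {b} contains at most lambda0; they exclude at most lambda0 m < r1
   of the shifts of the window [0, m), so some shift of the window avoids them
   all.  Thus multiplications by units form a PD-like set; the translations
   serve to move the errors away from the position 0, which every element of
   PAut(C^* ) fixes. *)

(** * Digit sums in base [q] *)

Section DigitSum.
Local Open Scope nat_scope.
Variable q : nat.
Hypothesis q_gt1 : 1 < q.
Implicit Types N M k i : nat.

(** The number [N] of digits is independent of [k], unlike the [k.+1] digits of [wtq], so that
    induction on [N] can strip the last digit. *)
Definition digit_sum N k := \sum_(i < N) (k %/ q ^ i) %% q.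

Lemma digit_sumS N k : digit_sum N.+1 k = k %% q + digit_sum N (k %/ q).
Proof.
rewrite /digit_sum big_ord_recl expn0 divn1; congr (_ + _).
by apply: eq_bigr => i _; rewrite lift0 expnS divnMA.
Qed.

Lemma digit_sum0 N : digit_sum N 0 = 0.
Proof. by rewrite /digit_sum big1 // => i _; rewrite div0n mod0n. Qed.

Lemma ltn_divq N k : k < q ^ N.+1 -> k %/ q < q ^ N.
Proof. by rewrite expnSr => hk; rewrite ltn_divLR // ltnW. Qed.

Lemma digit_sum_stable N M k :
  k < q ^ N -> k < q ^ M -> digit_sum N k = digit_sum M k.
Proof.
elim: N M k => [|N IHN] [|M] k //; rewrite ?expn0.
- by rewrite ltnS leqn0 => /eqP-> _; rewrite !digit_sum0.
- by rewrite [in k < 1]ltnS leqn0 => _ /eqP->; rewrite !digit_sum0.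
- by move=> hN hM; rewrite !digit_sumS (IHN M) // ltn_divq.
Qed.

Lemma wtq_digit_sum N k : k < q ^ N -> wtq q k = digit_sum N k.
Proof.
move=> hk; apply: digit_sum_stable hk.
by apply: (ltn_trans (ltnSn k)); apply: ltn_expl.
Qed.

(** All [N] digits of [q ^ N - 1] equal [q - 1], so the subtraction has no borrows and turns each
    digit [d] into [q - 1 - d]. *)
Lemma digit_sum_compl N k :
  k < q ^ N -> digit_sum N (q ^ N - 1 - k) + digit_sum N k = N * (q - 1).
Proof.
elim: N k => [|N IHN] k hk; first by rewrite /digit_sum !big_ord0.
have q_gt0 : 0 < q by exact: ltnW.
have hk' := ltn_divq hk; have hr := ltn_pmod k q_gt0.
(* Quotient and remainder by [q] of the complement are the complements of those of [k]. *)
have -> : q ^ N.+1 - 1 - k = (q ^ N - 1 - k %/ q) * q + (q - 1 - k %% q).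
  by rewrite {1}(divn_eq k q) expnSr; nia.
have hr' : q - 1 - k %% q < q by lia.
rewrite !digit_sumS modnMDl divnMDl // (divn_small hr') (modn_small hr').
by rewrite addn0 addnACA IHN // mulSn; lia.
Qed.

Lemma wtq_compl N k : k < q ^ N -> wtq q (q ^ N - 1 - k) + wtq q k = N * (q - 1).
Proof.
move=> hk; rewrite !(@wtq_digit_sum N) ?digit_sum_compl //.
by lia.
Qed.

Lemma digit_sum_eq0 N k : k < q ^ N -> digit_sum N k = 0 -> k = 0.
Proof.
elim: N k => [|N IHN] k hk; first by move: hk; rewrite expn0; lia.
rewrite digit_sumS => /eqP; rewrite addn_eq0 => /andP[/eqP r0 /eqP d0].
by rewrite (divn_eq k q) r0 (IHN _ (ltn_divq hk) d0).
Qed.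

Lemma digit_sum_eq1 N k :
  k < q ^ N -> digit_sum N k = 1 -> exists2 i, i < N & k = q ^ i.
Proof.
elim: N k => [|N IHN] k hk; first by rewrite /digit_sum big_ord0.
rewrite digit_sumS => hd; have hk' := ltn_divq hk.
case r0: (k %% q) hd => [|[|r]] // hd.
  have [i hi e] := IHN _ hk' hd; exists i.+1 => //.
  by rewrite (divn_eq k q) r0 e addn0 expnSr.
exists 0 => //; rewrite (divn_eq k q) r0 (@digit_sum_eq0 N (k %/ q)) //.
by case: hd.
Qed.

Lemma digit_sum_expn N i : i < N -> digit_sum N (q ^ i) = 1.
Proof.
elim: N i => [|N IHN] [|i] // hi; rewrite digit_sumS.
  by rewrite modn_small // divn_small // digit_sum0.
by rewrite expnSr modnMl mulnK ?IHN // ltnW.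
Qed.

Lemma wtq_expn i : wtq q (q ^ i) = 1.
Proof. by rewrite (@wtq_digit_sum i.+1) ?digit_sum_expn ?ltn_exp2l. Qed.

Lemma wtq_le1 N k :
  0 < k -> k < q ^ N -> wtq q k <= 1 -> exists2 i, i < N & k = q ^ i.
Proof.
move=> k_gt0 hk; rewrite (wtq_digit_sum hk) leq_eqVlt ltnS leqn0.
case/orP => /eqP; first exact: digit_sum_eq1.
by move/(digit_sum_eq0 hk) => k0; rewrite k0 in k_gt0.
Qed.

End DigitSum.

(** * Words, unique decoding, information sets and syndromes *)

Section Words.
Variables (K : finFieldType) (T : finType).
Implicit Types (C : {vspace word K T}) (x y v e : word K T) (I : {set T}).
Implicit Types (s t : {perm T}).

Lemma perm_wordD t x y : perm_word t (x + y) = perm_word t x + perm_word t y.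
Proof. by apply/ffunP => g; rewrite !ffunE. Qed.

Lemma perm_word1 x : perm_word 1 x = x.
Proof. by apply/ffunP => g; rewrite !ffunE invg1 perm1. Qed.

Lemma perm_wordM s t x : perm_word t (perm_word s x) = perm_word (s * t) x.
Proof. by apply/ffunP => g; rewrite !ffunE invMg permM. Qed.

Lemma perm_word_perm t x g : perm_word t x (t g) = x g.
Proof. by rewrite ffunE permK. Qed.

Lemma perm_word_inj t : injective (@perm_word K T t).
Proof.
by move=> x y /(congr1 (perm_word t^-1)); rewrite !perm_wordM mulgV !perm_word1.
Qed.

Lemma weight_perm t x : weight (perm_word t x) = weight x.
Proof.
rewrite /weight -(card_imset [set g | x g != 0] (@perm_inj _ t)).
congr #|pred_of_set _|; apply/setP => g; rewrite inE.
apply/idP/imsetP => [nz|[h + ->]]; last by rewrite inE perm_word_perm.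
by exists ((t^-1)%g g); rewrite ?permKV // inE -(perm_word_perm t) permKV.
Qed.

Lemma weightB x y : (weight (x - y)%R <= weight x + weight y)%N.
Proof.
apply: leq_trans (leq_card_setU _ _); apply/subset_leq_card/subsetP => g.
rewrite !inE !ffunE; apply: contraR; rewrite negb_or !negbK => /andP[/eqP-> /eqP->].
by rewrite subrr.
Qed.

Lemma weight_gt0 x : x != 0 -> (0 < weight x)%N.
Proof.
apply: contra_neqT; rewrite -leqNgt leqn0 cards_eq0 => /eqP w0.
apply/ffunP => g; rewrite ffunE; apply/eqP; apply: contraT => nz.
by rewrite -(in_set0 g) -w0 inE.
Qed.

Lemma PAut_mem C t x : t \in PAut C -> x \in C -> perm_word t x \in C.
Proof.
rewrite inE => /eqP/setP/(_ (perm_word t x)); rewrite !inE => <- xC.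
by apply/imsetP; exists x.
Qed.

(** Inclusion suffices: the action is injective and [C] is finite. *)
Lemma mem_PAut C t : {in C, forall x, perm_word t x \in C} -> t \in PAut C.
Proof.
move=> tC; rewrite inE eqEcard; apply/andP; split.
  by apply/subsetP => _ /imsetP[x xC ->]; rewrite inE tC.
rewrite card_imset; last exact: perm_word_inj.
by rewrite cardsE.
Qed.

Lemma min_dist_le C x y :
  x \in C -> y \in C -> x != y -> (min_dist C <= weight (x - y)%R)%N.
Proof.
move=> xC yC neq_xy.
pose P (p : word K T * word K T) := [&& p.1 \in C, p.2 \in C & p.1 != p.2].
have Pxy : P (x, y) by rewrite /P xC yC.
rewrite /min_dist; have := mem_index_enum (x, y).
elim: index_enum => //= p r IH; rewrite inE big_cons.
case/predU1P => [<-|/IH le_r]; first by rewrite -/(P (x, y)) Pxy geq_minl.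
by case: ifP => // _; apply: leq_trans (geq_minr _ _) le_r.
Qed.

(** A nonzero codeword [v - e] would have weight at most twice the error capability, which is below
    the minimum distance. *)
Lemma unique_decoding C v e :
  v - e \in C -> (weight v <= error_capability C)%N ->
  (weight e <= error_capability C)%N -> v = e.
Proof.
move=> veC wv we; apply/eqP; rewrite -subr_eq0; apply: contraT => nz.
have := min_dist_le veC (mem0v C) nz; rewrite subr0 => le_d.
(* The positive weight of [v - e] settles the degenerate value [min_dist C = 0], where [.-1]
   truncates. *)
have := leq_trans le_d (weightB v e); have := leq_trans (weight_gt0 nz) (weightB v e).
have := leq_addl (odd (min_dist C).-1) (min_dist C).-1./2.*2.
by move: wv we; rewrite odd_double_half -addnn /error_capability; lia.
Qed.

(** Restriction to [I] maps [C] onto all words on [I]; since [#|I| = \dim C], both sets have the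
    same cardinality, so the map is also injective. *)
Lemma information_set_inj C I : information_set C I ->
  forall x y, x \in C -> y \in C -> {in I, x =1 y} -> x = y.
Proof.
case=> cardI surj.
pose rho x : {ffun {g | g \in I} -> K} := [ffun g => x (val g)].
have : #|rho @: C| == #|C|.
  rewrite eqn_leq leq_imset_card.
  have -> : rho @: C = setT.
    apply/setP => a; rewrite inE; apply/imsetP.
    have [c cC ca] := surj [ffun g => if insub g is Some h then a h else 0].
    exists c => //; apply/ffunP => g; rewrite ffunE ca ?(valP g) // ffunE.
    by rewrite valK.
  by rewrite cardsT card_ffun card_sig card_vspace cardI leqnn.
move/imset_injP => rho_inj x y xC yC exy; apply: rho_inj => //.
by apply/ffunP => g; rewrite !ffunE exy // (valP g).
Qed.

Lemma codeword_from_error C I c e : information_set C I -> c \in C ->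
  {in I, forall g, e g = 0} -> codeword_from C I (c + e) = Some c.
Proof.
move=> infoI cC e0; rewrite /codeword_from; case: pickP => [c'|/(_ c)].
  case/andP => c'C /'forall_in_eqP c'c; congr Some.
  apply: (information_set_inj infoI) => // g gI.
  by rewrite c'c // ffunE e0 // addr0.
rewrite cC /= => /negP[]; apply/'forall_in_eqP => g gI.
by rewrite ffunE e0 // addr0.
Qed.

Section Syndrome.
Variables (C : {vspace word K T}) (I : {set T}) (r : nat) (H : 'M[K]_(r, #|T|)).

Lemma syndromeD x y : syndrome H (x + y) = syndrome H x + syndrome H y.
Proof.
rewrite /syndrome -mulmxDr -raddfD; congr (_ *m _^T).
by apply/rowP => j; rewrite !mxE ffunE.
Qed.

(** Only the identity columns meet the support of [v], so the syndrome lists the values of [v]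
    outside [I]. *)
Lemma syndrome_outside (f : 'I_r -> T) v :
  injective f -> [set f j | j : 'I_r] = ~: I ->
  (forall i j, H i (enum_rank (f j)) = (i == j)%:R) ->
  {in I, forall g, v g = 0} -> forall i, syndrome H v i 0 = v (f i).
Proof.
move=> f_inj f_im f_id v0 i.
rewrite mxE (reindex (@enum_rank T)) /=; last exact/onW_bij/enum_rank_bij.
rewrite (bigID (mem I)) /= big1; last first.
  by move=> g gI; rewrite !mxE enum_rankK v0 // mulr0.
rewrite add0r (eq_bigl (mem [set f j | j : 'I_r])); last first.
  by move=> g; rewrite f_im !inE.
rewrite big_imset /=; last by move=> j k _ _; apply: f_inj.
rewrite (bigD1 i) //= f_id eqxx mul1r !mxE enum_rankK big1 ?addr0 // => j.
by rewrite f_id eq_sym => /negPf->; rewrite mul0r.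
Qed.

Hypothesis std : std_parity_check C I H.

Lemma cweight_syndrome v :
  {in I, forall g, v g = 0} -> cweight (syndrome H v) = weight v.
Proof.
have [_ [f [f_inj f_im f_id]]] := std => v0.
rewrite /cweight /weight -(card_imset _ f_inj).
congr #|pred_of_set _|; apply/setP => g; rewrite inE.
apply/imsetP/idP => [[i + ->]|nz].
  by rewrite inE (syndrome_outside f_inj).
have : g \in [set f j | j : 'I_r].
  by rewrite f_im inE; apply: contra nz => /v0->.
by case/imsetP => i _ gi; exists i; rewrite // inE (syndrome_outside f_inj) -?gi.
Qed.

(** The identity columns alone generate every syndrome; the word [v] carries the entries of the
    syndrome at the positions [f k]. *)
Lemma syndrome_coset_leader x :
  exists2 v : word K T, {in I, forall g, v g = 0} & syndrome H v = syndrome H x.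
Proof.
have [_ [f [f_inj f_im f_id]]] := std.
pose v : word K T := [ffun g => \sum_(k | f k == g) syndrome H x k 0].
have v0 : {in I, forall g, v g = 0}.
  move=> g gI; rewrite ffunE big1 // => k /eqP fk.
  have : g \in ~: I by rewrite -f_im -fk imset_f.
  by rewrite inE gI.
exists v => //; apply/colP => i; rewrite (syndrome_outside f_inj) // ffunE.
by rewrite (bigD1 i) //= big1 ?addr0 // => k /andP[/eqP/f_inj->]; rewrite eqxx.
Qed.

(** The word [v] outside [I] with the syndrome of [e] has the weight of that syndrome. If this is
    within the error capability, unique decoding in the coset gives [v = e], so [e] vanishes on
    [I]. *)
Lemma syndrome_testP c e : c \in C -> (weight e <= error_capability C)%N ->
  reflect {in I, forall g, e g = 0}
    (cweight (syndrome H (c + e)%R) <= error_capability C)%N.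
Proof.
have [memC _] := std => cC we.
have -> : syndrome H (c + e) = syndrome H e.
  by move: cC; rewrite memC syndromeD => /eqP->; rewrite add0r.
apply: (iffP idP) => [|e0]; last by rewrite cweight_syndrome.
have [v v0 Hv] := syndrome_coset_leader e; rewrite -Hv cweight_syndrome // => wv.
suff <- : v = e by [].
apply: unique_decoding (wv) (we); rewrite memC.
have : syndrome H (v - e + e) == syndrome H e by rewrite subrK Hv.
by rewrite syndromeD -subr_eq0 addrK.
Qed.

End Syndrome.
End Words.

(** * Correctness of Algorithm I when some pair of permutations clears [I] *)

Section AlgorithmICorrect.
Variables (K F : finFieldType) (C : {vspace word K F}) (I : {set F}).
Variables (r : nat) (H : 'M[K]_(r, #|F|)) (P : seq {perm {unit F}}).
Hypothesis infoI : information_set C I.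
Hypothesis std : std_parity_check C I H.
Hypothesis PC : {in P, forall tau, ext0 tau \in PAut C}.

(** The test accepts exactly the pairs that move the errors out of [I]. Hence the first accepted
    pair, whichever it is, yields the right codeword, and the given pair keeps the search from
    failing. *)
Lemma algorithmI_along_correct (S : seq {perm F}) c e :
  {in S, forall sigma, sigma \in PAut C} -> c \in C ->
  (weight e <= error_capability C)%N ->
  (exists2 sigma, sigma \in S & exists2 tau, tau \in P &
     {in I, forall g, perm_word (sigma * ext0 tau) e g = 0}) ->
  algorithmI_along C I H P S (c + e) = Some c.
Proof.
move=> + cC we; elim: S => [|sigma S IH] SC; first by case.
have sC : sigma \in PAut C by rewrite SC ?mem_head.
have testP tau : tau \in P ->
  reflect {in I, forall g, perm_word (sigma * ext0 tau) e g = 0}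
    (cweight (syndrome H (perm_word (ext0 tau) (perm_word sigma (c + e)%R)))
      <= error_capability C)%N.
  move=> tauP; rewrite perm_wordM perm_wordD.
  apply: (syndrome_testP std); last by rewrite weight_perm.
  by rewrite -perm_wordM !PAut_mem ?PC.
case=> sigma1 s1S [tau1 tau1P e1].
rewrite /= /find_tau0; set Q := [seq tau <- P | _].
case EQ: Q => [|tau0 Q'] /=.
  apply: IH => [s sS|]; first by rewrite SC // inE sS orbT.
  exists sigma1; last by exists tau1.
  (* Since no element of [P] passes at [sigma], the good [sigma1] must lie further down the list. *)
  move: s1S; rewrite inE => /predU1P[s1|//].
  have : tau1 \in Q by rewrite mem_filter tau1P andbT; apply/testP; rewrite -?s1.
  by rewrite EQ.
have : tau0 \in Q by rewrite EQ mem_head.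
rewrite mem_filter => /andP[+ tau0P] => /(testP _ tau0P) e0.
rewrite perm_wordM perm_wordD codeword_from_error //=; last first.
  by rewrite -perm_wordM !PAut_mem ?PC.
by rewrite perm_wordM mulgV perm_word1.
Qed.

End AlgorithmICorrect.

(** * Power sums over finite fields and Vandermonde systems *)

Lemma finField_card_pchar (F : finFieldType) :
  exists p e, [/\ prime p, p \in [pchar F] & #|F| = (p ^ e.+1)%N].
Proof.
have [p p_pr p_char] := finPcharP F; exists p, (logn p #|F|).-1; split => //.
have cardF : #|F| = (p ^ logn p #|F|)%N := card_pprimeChar p_char.
rewrite prednK //; case: (logn p #|F|) cardF => // cardF.
by have := finNzRing_gt1 F; rewrite cardF.
Qed.

Lemma natr_card_finField (F : finFieldType) : #|F|%:R = 0 :> F.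
Proof.
have [p [e [_ p_char ->]]] := finField_card_pchar F.
by apply/eqP; rewrite -(dvdn_pcharf p_char) expnS dvdn_mulr.
Qed.

(** For [k = 0] the sum is [#|F|] times 1. Otherwise multiplication by a generator [x] permutes [F]
    and scales the sum by [x ^+ k], which is not 1. *)
Lemma sum_expr_eq0 (F : finFieldType) (k : nat) :
  (k == 0)%N || ~~ (#|F|.-1 %| k)%N -> \sum_(g : F) g ^+ k = 0.
Proof.
case: eqP => [-> _|_ /= ndvd].
  under eq_bigr do rewrite expr0.
  by rewrite sumr_const -[RHS]natr_card_finField.
have /cyclicP[x gen_x] := field_unit_group_cyclic [group of [set: {unit F}]].
have ox : #[x]%g = #|F|.-1 by rewrite /order -gen_x card_finField_unit.
have nz_x : val x != 0 by rewrite -unitfE; exact: (valP x).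
have xk1 : val x ^+ k != 1.
  apply: contra ndvd => /eqP xk1; rewrite -ox order_dvdn; apply/eqP/val_inj.
  by rewrite FinRing.val_unitX.
set S := \sum_g _.
have : val x ^+ k * S = S.
  rewrite mulr_sumr [RHS](reindex_inj (mulfI nz_x)) /=.
  by apply: eq_bigr => g _; rewrite exprMn.
move/eqP; rewrite -{2}[S]mul1r -subr_eq0 -mulrBl mulf_eq0 subr_eq0.
by rewrite (negPf xk1) => /eqP.
Qed.

(* [X^n + X^(n-1) Y + ... + Y^n = (X^#|F| - Y^#|F|) / (X - Y)], where
   [n = #|F| - 1]. *)
Lemma sum_expr_delta (F : finFieldType) (g h : F) :
  \sum_(k < #|F|) g ^+ (#|F|.-1 - k) * h ^+ k = (g != h)%:R.
Proof.
case: eqVneq => [<-|neq_gh] /=.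
  have e : forall k : 'I_#|F|, true -> g ^+ (#|F|.-1 - k) * g ^+ k = g ^+ #|F|.-1.
    by move=> k _; rewrite -exprD subnK // -ltnS prednK // ltnW // finNzRing_gt1.
  rewrite (eq_bigr _ e) sumr_const card_ord -[LHS]mulr_natr.
  by rewrite natr_card_finField mulr0.
have nz : g - h != 0 by rewrite subr_eq0.
by apply: (mulfI nz); rewrite -subrXX !expf_card mulr1.
Qed.

Lemma det_Vandermonde_neq0 (F : fieldType) (d : nat) (a : 'rV[F]_d) :
  injective (a 0) -> \det (Vandermonde d a) != 0.
Proof.
move=> inj_a; rewrite det_Vandermonde prodf_seq_neq0; apply/allP => i _ /=.
rewrite prodf_seq_neq0; apply/allP => j _ /=; apply/implyP => lt_ij.
by rewrite subr_eq0; apply: contraL lt_ij => /eqP/inj_a->; rewrite ltnn.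
Qed.

(** The moments are the entries of [c] times a transposed Vandermonde matrix, invertible since the
    nodes are distinct. *)
Lemma power_moments_eq0 (F : fieldType) (d : nat) (a c : 'I_d -> F) :
  injective a -> (forall j, (j < d)%N -> \sum_i c i * a i ^+ j = 0) ->
  forall i, c i = 0.
Proof.
move=> inj_a moments i.
pose V := Vandermonde d (\row_i a i).
have V_unit : V^T \in unitmx.
  rewrite unitmx_tr unitmxE unitfE det_Vandermonde_neq0 //.
  by move=> u v; rewrite !mxE => /inj_a.
have : (\row_i c i) *m V^T = 0.
  apply/rowP => j; rewrite !mxE -[RHS](moments j) //.
  by apply: eq_bigr => k _; rewrite !mxE.
move/(congr1 (mulmx^~ (invmx V^T))); rewrite mulmxK // mul0mx.
by move/rowP/(_ i); rewrite !mxE.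
Qed.

(** * The first-order GRM code as a code of affine q-polynomials *)

Section FirstOrderGRM.
Variables (K F : finFieldType) (emb : {rmorphism K -> F}) (m : nat).
Local Notation q := #|K|.
Hypothesis card_F : #|F| = (q ^ m)%N.
(** This puts [phi_ 0] among the defining checks, because the weight of [0] is then below the bound
    [m * (q - 1) - 1]. *)
Hypothesis nontrivial : (1 < m * (q - 1))%N.
Local Notation C := (GRM1 emb m).

Let m_gt0 : (0 < m)%N. Proof. by case: m nontrivial. Qed.

Lemma frobeniusD i (x y : F) :
  (x + y) ^+ (q ^ i) = x ^+ (q ^ i) + y ^+ (q ^ i).
Proof.
have [p [e [p_pr p_char ->]]] := finField_card_pchar K.
have p_charF := rmorph_pchar emb p_char.
apply: exprDn_pchar; rewrite (eq_pnat _ (pcharf_eq p_charF)).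
by rewrite !pnatX pnat_id.
Qed.

(** Over [K], the polynomial X^q - X is the product of all X - a; mapped by [emb] and evaluated at
    [y], one factor must vanish. *)
Lemma mem_emb_image (y : F) : y ^+ q = y -> exists a, emb a = y.
Proof.
move=> yq.
have := congr1 (fun p => (map_poly emb p).[y]) (finField_genPoly K).
rewrite /= rmorphB /= map_polyXn map_polyX !hornerE yq subrr.
rewrite rmorph_prod horner_prod => /esym/eqP; rewrite prodf_seq_eq0.
case/hasP => a _ /=; rewrite rmorphB /= map_polyX map_polyC !hornerE subr_eq0.
by move/eqP=> ->; exists a.
Qed.

Definition qpoly (c : 'I_m -> F) (g : F) : F := \sum_i c i * g ^+ (q ^ i).

Definition qaffine (f : F -> F) : Prop :=
  exists (c0 : F) (c : 'I_m -> F), forall g, f g = c0 + qpoly c g.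

Let q_gt1 : (1 < q)%N. Proof. exact: finNzRing_gt1. Qed.

Lemma qpoly0 c : qpoly c 0 = 0.
Proof.
rewrite /qpoly big1 // => i _.
by rewrite expr0n expn_eq0 -leqn0 leqNgt ltnW ?q_gt1 // mulr0.
Qed.

Lemma qpolyD c g h : qpoly c (g + h) = qpoly c g + qpoly c h.
Proof.
by rewrite -big_split; apply: eq_bigr => i _; rewrite frobeniusD mulrDr.
Qed.

Lemma eq_qaffine f1 f2 : f1 =1 f2 -> qaffine f1 -> qaffine f2.
Proof. by move=> ef [a [c e]]; exists a, c => g; rewrite -ef e. Qed.

Lemma qaffine_cst a : qaffine (fun=> a).
Proof.
exists a, (fun=> 0) => g; rewrite /qpoly big1 ?addr0 // => i _.
by rewrite mul0r.
Qed.

Lemma qaffineD f1 f2 :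
  qaffine f1 -> qaffine f2 -> qaffine (fun g => f1 g + f2 g).
Proof.
move=> [a [c Ef1]] [b [d Ef2]]; exists (a + b), (fun i => c i + d i) => g.
rewrite Ef1 Ef2 addrACA; congr (_ + _); rewrite -big_split.
by apply: eq_bigr => i _; rewrite mulrDl.
Qed.

Lemma qaffine_sum (T : finType) (f : T -> F -> F) :
  (forall k, qaffine (f k)) -> qaffine (fun g => \sum_k f k g).
Proof.
move=> hf; rewrite /index_enum; elim: (Finite.enum T) => [|k r IH].
  by apply: eq_qaffine (qaffine_cst 0) => g; rewrite big_nil.
by apply: eq_qaffine (qaffineD (hf k) IH) => g; rewrite big_cons.
Qed.

Lemma qaffine_monomial (a : F) i : (i < m)%N -> qaffine (fun g => a * g ^+ (q ^ i)).
Proof.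
move=> lt_im; exists 0, (fun j => if j == Ordinal lt_im then a else 0) => g.
rewrite add0r /qpoly (bigD1 (Ordinal lt_im)) //= eqxx big1 ?addr0 // => j.
by move/negPf->; rewrite mul0r.
Qed.

Let qm_gt1 : (1 < q ^ m)%N. Proof. by rewrite -card_F finNzRing_gt1. Qed.

(* [emb (x g) = phi_0 x - \sum_(k <= n) g^(n-k) phi_k x]; for codewords only
   the exponents [n - k] of weight at most one survive. *)
Lemma mem_GRM1_qaffine (x : word K F) :
  x \in C <-> qaffine (fun g => emb (x g)).
Proof.
rewrite mem_GRM1; split.
  move/forallP => hx.
  have phix0 j : (j < q ^ m - 1)%N -> (wtq q j < m * (q - 1) - 1)%N -> phi_ emb j x = 0.
    by move=> lt_j wj; apply/eqP; apply: (implyP (hx (Ordinal lt_j))).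
  have phi00 : phi_ emb 0 x = 0.
    apply: phix0; first by lia.
    by rewrite (@wtq_digit_sum _ q_gt1 m) ?digit_sum0; lia.
  have interp g : emb (x g) =
      \sum_(k < #|F|) - (phi_ emb k x * g ^+ (#|F|.-1 - k)).
    (* The factor is the indicator of [h = g]. Its summand 1 contributes [phi_ emb 0 x = 0], and
       [sum_expr_delta] expands the rest. *)
    have -> : emb (x g) = \sum_h emb (x h) * (1 - (g != h)%:R).
      rewrite (bigD1 g) //= eqxx subr0 mulr1 big1 ?addr0 // => h.
      by rewrite eq_sym => ->; rewrite subrr mulr0.
    under eq_bigr => h _ do rewrite mulrBr mulr1 -sum_expr_delta.
    rewrite sumrB.
    have -> : \sum_h emb (x h) = 0.
      by rewrite -[RHS]phi00; apply: eq_bigr => h _; rewrite expr0 mulr1.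
    rewrite sub0r sumrN; congr (- _).
    under eq_bigr do rewrite mulr_sumr.
    rewrite exchange_big; apply: eq_bigr => k _; rewrite mulr_suml.
    by apply: eq_bigr => h _; rewrite -mulrA [_ ^+ k * _]mulrC.
  apply: (eq_qaffine (fun g => esym (interp g))).
  apply: qaffine_sum => k.
  have lt_k : (k < q ^ m)%N by rewrite -card_F.
  rewrite (_ : #|F|.-1 = q ^ m - 1)%N; last by rewrite card_F subn1.
  (* The last index gives exponent 0, that is the constant term. *)
  have [ek|nek] := eqVneq (k : nat) (q ^ m - 1)%N.
    apply: eq_qaffine (qaffine_cst (- phi_ emb k x)) => g.
    by rewrite ek subnn expr0 mulr1.
  have lt_k' : (k < q ^ m - 1)%N by lia.
  have [wk|wk] := ltnP (wtq q k) (m * (q - 1) - 1).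
    by apply: eq_qaffine (qaffine_cst 0) => g; rewrite phix0 // mul0r oppr0.
  (* Here [wtq q k] is at least [m * (q - 1) - 1], so the positive complementary exponent has weight
     at most 1 and is a power of [q]. *)
  have wcompl := wtq_compl q_gt1 lt_k.
  have [|||i lt_im ->] := @wtq_le1 _ q_gt1 m (q ^ m - 1 - k); try by lia.
  apply: eq_qaffine (qaffine_monomial (- phi_ emb k x) lt_im) => g.
  by rewrite mulNr.
case=> c0 [c Ex]; apply/forallP => -[j lt_j]; apply/implyP => /= wj.
rewrite /phi_; under eq_bigr => g _ do rewrite Ex mulrDl mulr_suml.
rewrite big_split /= -mulr_sumr sum_expr_eq0; last first.
  rewrite card_F; case: (posnP j) => [->|j_gt0] //=.
  by rewrite gtnNdvd ?orbT // -subn1.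
rewrite mulr0 add0r exchange_big /= big1 // => i _.
under eq_bigr => g _ do rewrite -mulrA -exprD.
rewrite -mulr_sumr sum_expr_eq0 ?mulr0 //.
have lt_qi : (q ^ i < q ^ m)%N by rewrite ltn_exp2l ?q_gt1.
have qi_gt0 : (0 < q ^ i)%N by rewrite expn_gt0 ltnW ?q_gt1.
rewrite (_ : #|F|.-1 = q ^ m - 1)%N; last by rewrite card_F subn1.
(* Suppose [q ^ i + j] is a multiple of [q ^ m - 1]. The factor 0 contradicts positivity; the factor
   1 makes [j] the complement of [q ^ i], of weight exactly [m * (q - 1) - 1]; larger factors are
   too big. *)
apply/orP; right; apply/negP => /dvdnP[[|[|l]] e].
- by move: e; rewrite mul0n; lia.
- have := wtq_compl q_gt1 lt_qi; rewrite wtq_expn ?q_gt1 //.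
  have <- : j = (q ^ m - 1 - q ^ i)%N by rewrite -[j](addKn (q ^ i)%N) e mul1n.
  by move=> ew; move: wj; rewrite -ew addnK ltnn.
- have : (q ^ i + j < l.+2 * (q ^ m - 1))%N; last by rewrite e ltnn.
  rewrite !mulSn addnA (leq_trans _ (leq_addr _ _)) // -addnS leq_add //.
  by rewrite subn1 -ltnS prednK // ltnW.
Qed.

(** As [qpoly c] is additive, a translation only changes the constant term. *)
Lemma GRM1_translation a : translation a \in PAut C.
Proof.
apply: mem_PAut => x /mem_GRM1_qaffine[c0 [c Ex]].
apply/mem_GRM1_qaffine; exists (c0 + qpoly c (- a)), c => g.
have ta : (translation a)^-1%g g = g - a.
  by apply: (canLR (permK _)); rewrite permE subrK.
by rewrite ffunE ta Ex -addrA qpolyD [qpoly c g + _]addrC.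
Qed.

Definition unit_mul (v : {unit F}) : {perm {unit F}} := perm (mulgI v).

(** A multiplication rescales each coefficient [c i] by a [q ^ i]-th power. *)
Lemma GRM1_unit_mul v : unit_mul v \in PAut (puncture C).
Proof.
apply: mem_PAut => _ /mem_puncture[x /mem_GRM1_qaffine[c0 [c Ex]] ->].
apply/mem_puncture; exists [ffun g => x (val v^-1%g * g)].
  apply/mem_GRM1_qaffine; exists c0, (fun i => c i * val v^-1%g ^+ (q ^ i)) => g.
  rewrite ffunE Ex; congr (_ + _); apply: eq_bigr => i _.
  by rewrite exprMn mulrA.
apply/ffunP => u; rewrite !ffunE -FinRing.val_unitM; congr (x (val _)).
by apply: (canLR (permK _)); rewrite permE mulKVg.
Qed.

Lemma ext0_0 (tau : {perm {unit F}}) : ext0 tau 0 = 0.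
Proof.
rewrite permE /ext0_fun; case: insubP => // u.
by rewrite unitr0.
Qed.

Lemma ext0_val (tau : {perm {unit F}}) u : ext0 tau (val u) = val (tau u).
Proof. by rewrite permE /ext0_fun valK. Qed.

Lemma restr_ext0 (tau : {perm {unit F}}) (x : word K F) :
  restr (perm_word (ext0 tau) x) = perm_word tau (restr x).
Proof.
apply/ffunP => u; rewrite !ffunE; congr (x _).
by apply: (canLR (permK _)); rewrite ext0_val permKV.
Qed.

Lemma GRM1_sum_eq0 x : x \in C -> \sum_g x g = 0.
Proof.
rewrite mem_GRM1 => /forallP hx; have q1 := finNzRing_gt1 K.
have n_gt0 : (0 < q ^ m - 1)%N by rewrite subn_gt0 -(expn0 q) ltn_exp2l.
have := hx (Ordinal n_gt0).
rewrite /= (@wtq_digit_sum _ q1 0) // digit_sum0 subn_gt0 nontrivial => /eqP phi0.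
apply: (fmorph_inj emb); rewrite rmorph_sum rmorph0 -[RHS]phi0.
by apply: eq_bigr => g _; rewrite expr0 mulr1.
Qed.

(* A codeword of [C] is determined by its punctured part, its entries adding
   up to zero. *)
Lemma GRM1_ext0 (tau : {perm {unit F}}) :
  tau \in PAut (puncture C) -> ext0 tau \in PAut C.
Proof.
move=> tauC; apply: mem_PAut => x xC.
have : perm_word tau (restr x) \in puncture C.
  by apply: PAut_mem tauC _; apply/mem_puncture; exists x.
case/mem_puncture => y yC; rewrite -restr_ext0 => e.
suff -> : perm_word (ext0 tau) x = y by [].
have e_nz g : g != 0 -> perm_word (ext0 tau) x g = y g.
  move=> nz; have Ug : g \is a GRing.unit by rewrite unitfE.
  have := congr1 (fun w : word K {unit F} => w (FinRing.unit F Ug)) e.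
  by rewrite !ffunE.
apply/ffunP => g; have [->|/e_nz//] := eqVneq g 0.
have : \sum_g perm_word (ext0 tau) x g = \sum_g y g.
  rewrite (GRM1_sum_eq0 yC) -[RHS](GRM1_sum_eq0 xC).
  rewrite (reindex_inj (@perm_inj _ (ext0 tau))).
  by apply: eq_bigr => h _; rewrite perm_word_perm.
rewrite (bigD1 0) //= [in RHS](bigD1 0) //= (eq_bigr y); last by move=> h /e_nz.
by move/addIr.
Qed.

(** The [qpoly] here is the trace from [F] to [K] of [a * g]. Its values lie in the image of [emb],
    so [pick] succeeds and the default 0 is never taken. *)
Definition trace_word (b : K) (a : F) : word K F :=
  [ffun g => b + odflt 0 [pick k | emb k == qpoly (fun i => a ^+ (q ^ i)) g]].

Lemma emb_trace_word b a g :
  emb (trace_word b a g) = emb b + qpoly (fun i => a ^+ (q ^ i)) g.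
Proof.
rewrite ffunE rmorphD; congr (_ + _); case: pickP => [k /eqP//|no_k].
suff [k ek] : exists k, emb k = qpoly (fun i => a ^+ (q ^ i)) g.
  by have := no_k k; rewrite ek eqxx.
apply: mem_emb_image.
have e0 i : a ^+ (q ^ i) * g ^+ (q ^ i) = (a * g) ^+ (q ^ i) by rewrite exprMn.
have sumq (f : 'I_m -> F) : (\sum_i f i) ^+ q = \sum_i f i ^+ q.
  have qX (x y : F) : (x + y) ^+ q = x ^+ q + y ^+ q.
    by have := frobeniusD 1 x y; rewrite expn1.
  elim/big_ind2: _ => // [|x x' y y' <- <-]; last by rewrite qX.
  by rewrite expr0n -leqn0 leqNgt ltnW ?finNzRing_gt1.
rewrite /qpoly; under eq_bigr do rewrite e0.
(* The q-th power shifts the summands cyclically: the last one becomes the first because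
   [(a * g) ^+ (q ^ m) = a * g]. *)
rewrite sumq; case: m m_gt0 card_F => // m' _ cF.
rewrite [LHS]big_ord_recr [RHS]big_ord_recl /= addrC -exprM -expnSr -cF.
rewrite expf_card expn0 expr1; congr (_ + _).
by apply: eq_bigr => i _; rewrite -exprM -expnSr.
Qed.

Lemma trace_word_GRM1 b a : trace_word b a \in C.
Proof.
apply/mem_GRM1_qaffine; exists (emb b), (fun i => a ^+ (q ^ i)) => g.
exact: emb_trace_word.
Qed.

(** Exchanging exponents, [qpoly c (beta ^+ j)] is the [j]-th moment of [c] at the nodes
    [beta ^+ (q ^ i)]. *)
Lemma qpoly_powers_eq0 (beta : F) (c : 'I_m -> F) :
  injective (fun i : 'I_m => beta ^+ (q ^ i)) ->
  (forall j, (j < m)%N -> qpoly c (beta ^+ j) = 0) -> forall i, c i = 0.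
Proof.
move=> inj_b c0; apply: power_moments_eq0 inj_b _ => j lt_j.
rewrite -[RHS](c0 j lt_j); apply: eq_bigr => i _.
by rewrite -!exprM mulnC.
Qed.

(** Restriction to [I] is injective on [C], and the [q ^ m.+1] trace words are as many as the words
    on [I]. So they restrict onto all of these, and counting [C] also yields its dimension. *)
Lemma GRM1_information_set (beta : F) (I : {set F}) :
  injective (fun i : 'I_m => beta ^+ (q ^ i)) ->
  0 \in I -> (forall j, (j < m)%N -> beta ^+ j \in I) -> #|I| = m.+1 ->
  information_set C I.
Proof.
move=> inj_b I0 Ib cardI.
have inj_qpoly (c d : 'I_m -> F) :
    (forall j, (j < m)%N -> qpoly c (beta ^+ j) = qpoly d (beta ^+ j)) -> c =1 d.
  move=> ecd i; apply/eqP; rewrite -subr_eq0; apply/eqP; move: i.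
  apply: (@qpoly_powers_eq0 beta _ inj_b) => j lt_j.
  apply: etrans (_ : qpoly c (beta ^+ j) - qpoly d (beta ^+ j) = _).
    by rewrite -sumrB; apply: eq_bigr => i _; rewrite mulrBl.
  by rewrite ecd ?subrr.
have qp0 c : qpoly c 0 = 0 by exact: qpoly0.
pose rho (x : word K F) : {ffun {g | g \in I} -> K} := [ffun g => x (val g)].
have rhoE x y : rho x = rho y -> {in I, x =1 y}.
  move=> e g gI; have := congr1 (fun f : {ffun _ -> _} => f (exist _ g gI)) e.
  by rewrite !ffunE.
have rho_inj : {in C &, injective rho}.
  move=> x y /mem_GRM1_qaffine[c0 [c Ex]] /mem_GRM1_qaffine[d0 [d Ey]] /rhoE exy.
  have e0 : c0 = d0.
    by have := congr1 emb (exy 0 I0); rewrite Ex Ey !qp0 !addr0.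
  have ecd : c =1 d.
    apply: inj_qpoly => j /Ib/exy/(congr1 emb).
    by rewrite Ex Ey e0 => /addrI.
  apply/ffunP => g; apply: (fmorph_inj emb); rewrite Ex Ey e0; congr (_ + _).
  by apply: eq_bigr => i _; rewrite ecd.
pose w (p : K * F) := rho (trace_word p.1 p.2).
have w_inj : injective w.
  move=> [b a] [b' a'] /rho_inj; rewrite !trace_word_GRM1 /= => /(_ isT isT) e.
  have emb_e g : emb b + qpoly _ g = emb b' + qpoly _ g :=
    etrans (esym (emb_trace_word b a g))
      (etrans (congr1 (fun x : word K F => emb (x g)) e) (emb_trace_word b' a' g)).
  have eb : b = b'.
    by apply: (fmorph_inj emb); have := emb_e 0; rewrite !qp0 !addr0.
  rewrite eb; congr (_, _).
  (* The coefficient of index 0 is [a ^+ (q ^ 0)], which recovers [a]. *)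
  have /inj_qpoly/(_ (Ordinal m_gt0)) : forall j, (j < m)%N ->
    qpoly (fun i => a ^+ (q ^ i)) (beta ^+ j) =
    qpoly (fun i => a' ^+ (q ^ i)) (beta ^+ j).
    by move=> j _; have := emb_e (beta ^+ j); rewrite eb => /addrI.
  by rewrite expn0 !expr1.
have card_rho : #|{: {ffun {g | g \in I} -> K}}| = (q ^ m.+1)%N.
  by rewrite card_ffun card_sig cardI.
have w_onto f : f \in codom w.
  by apply: inj_card_onto w_inj _ f; rewrite card_rho card_prod card_F expnS.
split; last first.
  move=> a; have /codomP[p ep] := w_onto [ffun g => a (val g)].
  exists (trace_word p.1 p.2); first exact: trace_word_GRM1.
  move=> g gI; have := congr1 (fun f : {ffun _ -> _} => f (exist _ g gI)) ep.
  by rewrite !ffunE.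
apply/eqP; rewrite cardI -(@eqn_exp2l q) ?finNzRing_gt1 //.
have := card_vspace C => /= <-; rewrite -card_rho.
have /imset_injP/eqP <- := rho_inj.
rewrite -cardsT; apply/eqP/eq_card => f; rewrite inE; apply/esym/imsetP.
have /codomP[p ->] := w_onto f.
by exists (trace_word p.1 p.2); rewrite ?trace_word_GRM1.
Qed.
End FirstOrderGRM.

(** * Positions indexed by ['Z_r1 * 'Z_r2] and the PD-like set *)

Lemma is_lambda0_ltn m r1 l : is_lambda0 m r1 l -> (m * l < r1)%N /\ (0 < l)%N.
Proof.
(* For the integer [m], lying below the ceiling of a number is the same as lying below the
   number. *)
case=> -[l_gt0 +] _; rewrite Num.Theory.ceil_gt_int.
rewrite Num.Theory.ltr_pdivlMr ?Num.Theory.ltr0n //.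
by rewrite -!pmulrn -natrM Num.Theory.ltr_nat.
Qed.

(** [PD_like] speaks of sets of exactly [s] positions, whereas fewer errors may occur. *)
Lemma card_subset_extend (T : finType) (A : {set T}) s :
  (#|A| <= s)%N -> (s <= #|T|)%N -> exists2 B : {set T}, A \subset B & #|B| = s.
Proof.
move=> le_As; elim: s le_As => [|s IH] le_As le_sT.
  by exists A => //; apply/eqP; rewrite -leqn0.
move: le_As; rewrite leq_eqVlt => /predU1P[cA|]; first by exists A.
rewrite ltnS => /IH[|B sAB cB]; first exact: ltnW.
have /subsetPn[x _ xB] : ~~ ([set: T] \subset B).
  by apply: contraL le_sT => /subset_leq_card; rewrite cardsT cB -leqNgt.
exists (x |: B); last by rewrite cardsU1 xB cB.
by rewrite (subset_trans sAB) // subsetUr.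
Qed.

Section Positions.
Variables (F : finFieldType) (alpha : {unit F}) (n r1 r2 m : nat).
Hypothesis card_units : #|F|.-1 = n.
Hypothesis alpha_gen : generator [set: {unit F}] alpha.
Hypotheses (n_gt1 : (1 < n)%N) (r1_gt1 : (1 < r1)%N) (r2_gt1 : (1 < r2)%N).
Variable phi : {additive 'Z_n -> 'Z_r1 * 'Z_r2}.
Hypothesis phi_bij : bijective phi.

Lemma phi_onto p : exists i, phi i == p.
Proof. by have [g _ gK] := phi_bij; exists (g p); rewrite gK. Qed.

(** The inverse of [phi] followed by exponentiation of [alpha]: a group isomorphism onto the nonzero
    positions. *)
Definition position (p : 'Z_r1 * 'Z_r2) : {unit F} :=
  (alpha ^+ nat_of_ord (xchoose (phi_onto p)))%g.

Lemma order_alpha : #[alpha]%g = n.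
Proof.
by rewrite /order -(eqP (alpha_gen : _ == _)) card_finField_unit.
Qed.

Lemma positionE i : position (phi i) = (alpha ^+ nat_of_ord i)%g.
Proof.
by congr (_ ^+ nat_of_ord _)%g; apply/(bij_inj phi_bij)/eqP/(xchooseP (phi_onto (phi i))).
Qed.

Lemma positionD p p' : position (p + p') = (position p * position p')%g.
Proof.
have [i /eqP<-] := phi_onto p; have [j /eqP<-] := phi_onto p'.
have e : nat_of_ord (i + j) = ((i + j) %% n)%N :=
  congr1 (modn (i + j)%N) (Zp_cast n_gt1).
by rewrite -raddfD !positionE -expgD e expg_mod // -order_alpha expg_order.
Qed.

Lemma position_inj : injective position.
Proof.
move=> p p'; have [i /eqP<-] := phi_onto p; have [j /eqP<-] := phi_onto p'.
rewrite !positionE => /eqP; rewrite eq_expg_mod_order order_alpha.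
have lt k : (nat_of_ord (k : 'Z_n) < n)%N by rewrite -[X in (_ < X)%N]Zp_cast.
by rewrite !modn_small ?lt // => /eqP/val_inj->.
Qed.

Lemma position_onto u : exists p, u = position p.
Proof.
have : u \in <[alpha]>%g by rewrite -(eqP (alpha_gen : _ == _)) inE.
case/cycleP => k ->; exists (phi (inZp k)); rewrite positionE /= Zp_cast //.
by rewrite -order_alpha expg_mod_order.
Qed.

(* A notation, because in group_scope the pair (1, 0) would be (0, 0). *)
Local Notation beta := (position (1, 0)).

Lemma position_beta k :
  position (k%:R, 0) = (beta ^+ k)%g.
Proof.
elim: k => [|k IH].
  by rewrite expg0; apply: (mulgI (position (0, 0))); rewrite -positionD addr0 mulg1.
rewrite expgS -IH -positionD; congr position.
by apply: injective_projections; rewrite /= ?addr0 // -mulrS.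
Qed.

(** The second coordinate in [Gamma] is forced to be 0, which leaves multiples of [(1, 0)]; [m < r1]
    keeps the exponents below [m] unreduced. *)
Lemma GammaInfoSetE : (m < r1)%N ->
  GammaInfoSet alpha m phi = 0 |: [set val (beta) ^+ j | j : 'I_m].
Proof.
move=> lt_m; rewrite /GammaInfoSet; congr (_ |: _); apply/setP => g.
apply/imsetP/imsetP => [[i + ->]|[j _ ->]].
  rewrite !inE => /andP[lt_i]; rewrite ltnS leqn0 => /eqP i2.
  exists (Ordinal lt_i) => //=.
  rewrite -!FinRing.val_unitX -positionE -position_beta natr_Zp.
  by congr (val (position _)); apply: injective_projections => //; apply: val_inj.
have [i /eqP ei] := phi_onto ((j : nat)%:R, 0).
exists i; last first.
  by rewrite -!FinRing.val_unitX -positionE -position_beta ei.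
by rewrite !inE ei /= val_Zp_nat // modn_small ?ltn_ord // (ltn_trans _ lt_m).
Qed.

Lemma position_beta_eq i j :
  (beta ^+ i == beta ^+ j)%g = (i == j %[mod r1]).
Proof.
rewrite -!position_beta (inj_eq position_inj) xpair_eqE eqxx andbT.
by rewrite -val_eqE /= !val_Zp_nat.
Qed.

(** Two pigeonhole arguments: one finds a sparse column [b], the other a first coordinate [a] whose
    window in that column avoids [E]. *)
Lemma shift_PD_like l s (J : {set {unit F}}) :
  (m * l < r1)%N -> (s < l.+1 * r2)%N ->
  {in J, forall u, exists2 k, (k < m)%N & u = (beta ^+ k)%g} ->
  PD_like s J [set unit_mul v | v : {unit F}].
Proof.
move=> lt_ml lt_s powJ E cardE.
pose col b := [set a : 'Z_r1 | position (a, b) \in E].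
have card_col : (\sum_(b : 'Z_r2) #|col b| = s)%N.
  have -> : s = #|[set p | position p \in E]|.
    rewrite -cardE -(card_imset _ position_inj); apply: eq_card => u.
    apply/idP/imsetP => [uE|[p + ->]]; last by rewrite inE.
    by have [p ep] := position_onto u; exists p; rewrite // inE -ep.
  rewrite -sum1_card (eq_bigl (fun p => true && (position (p.1, p.2) \in E))).
    rewrite -(pair_big_dep xpredT (fun a b => position (a, b) \in E) (fun _ _ => 1%N)).
    rewrite (exchange_big_dep xpredT) //=; apply: eq_bigr => b _.
    by rewrite -sum1_card; apply: eq_bigl => a; rewrite inE.
  by case=> a b; rewrite inE.
(* Otherwise each of the [r2] columns would contain at least [l.+1] elements, against the bound on
   [s]. *)
have [b le_b] : exists b, (#|col b| <= l)%N.
  apply/existsP; apply: contraLR lt_s; rewrite negb_exists -leqNgt => /forallP big_b.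
  rewrite -card_col mulnC -[X in (X * _)%N](Zp_cast r2_gt1) -[X in (X * _)%N]card_ord.
  by rewrite -sum_nat_const leq_sum // => b _; rewrite ltnNge.
(* The starting points [a] from which some [a + k] with [k < m] hits column [b]. *)
pose bad := [set p.1 - p.2 | p in setX (col b) [set k : 'Z_r1 | (k < m)%N]].
have lt_bad : (#|bad| < #|{: 'Z_r1}|)%N.
  rewrite card_ord Zp_cast //; apply: leq_ltn_trans lt_ml; rewrite mulnC.
  apply: leq_trans (leq_imset_card _ _) _; rewrite cardsX leq_mul //.
  have small_k : [set k : 'Z_r1 | (k < m)%N] \subset [set inZp j | j : 'I_m].
    apply/subsetP => k; rewrite inE => lt_k.
    by apply/imsetP; exists (Ordinal lt_k); rewrite //= valZpK.
  apply: leq_trans (subset_leq_card small_k) _.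
  by apply: leq_trans (leq_imset_card _ _) _; rewrite card_ord.
have [a] : exists a, a \notin bad.
  apply/existsP; apply: contraLR lt_bad; rewrite negb_exists -leqNgt => /forallP all_bad.
  by apply/subset_leq_card/subsetP => a _; have := all_bad a; rewrite negbK.
(* Division by [position (a, b)] carries the window starting at [(a, b)] to the powers of [beta]
   with exponent below [m], which contain [J]. *)
move=> good_a; exists (unit_mul (position (a, b))^-1%g); first exact: imset_f.
rewrite disjoint_subset; apply/subsetP => _ /imsetP[w wE ->]; rewrite inE.
apply: contra good_a => /powJ[k lt_k]; rewrite permE -position_beta => ew.
have ew' : w = position (a + k%:R, b).
  rewrite -[w](mulKVg (position (a, b))) ew -positionD; congr position.
  by apply: injective_projections; rewrite /= ?addr0.
have k_small : (k%:R : 'Z_r1) \in [set k : 'Z_r1 | (k < m)%N].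
  by rewrite inE val_Zp_nat // (leq_ltn_trans (leq_mod _ _)).
apply/imsetP; exists (a + k%:R, k%:R); last by rewrite /= addrK.
by rewrite in_setX k_small inE -ew' wE.
Qed.

End Positions.

(** * Moving all errors out of the information set *)

Section ErrorLocation.
Variables (K F : finFieldType) (alpha : {unit F}).
Hypothesis alpha_gen : generator [set: {unit F}] alpha.

(** Some position [a] is free of error; the translation by [- a] brings it to 0, and [- a], if
    nonzero, is a power of [alpha]. *)
Lemma Sigma_clear0 (e : word K F) : (weight e < #|F|)%N ->
  exists2 sigma, sigma \in Sigma alpha & perm_word sigma e 0 = 0.
Proof.
move=> we; have [e0|e0] := eqVneq (e 0) 0.
  by exists 1%g; rewrite ?mem_head ?perm_word1.
have [a ea] : exists a, e a = 0.
  have /subsetPn[a _] : ~~ ([set: F] \subset [set g | e g != 0]).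
    by apply: contraL we => /subset_leq_card; rewrite cardsT -leqNgt.
  by rewrite inE negbK => /eqP; exists a.
have nz_a : - a != 0 by rewrite oppr_eq0; apply: contraNneq e0 => <-; rewrite ea.
have Ua : - a \is a GRing.unit by rewrite unitfE.
have : FinRing.unit F Ua \in <[alpha]>%g.
  by rewrite -(eqP (alpha_gen : _ == _)) inE.
case/cyclePmin => k lt_k ak; exists (translation (- a)); last first.
  have -> : 0 = translation (- a) a by rewrite permE subrr.
  by rewrite perm_word_perm ea.
rewrite inE; apply/orP; right; apply/mapP; exists k.
  rewrite mem_iota /= add0n (leq_trans lt_k) // -card_finField_unit.
  by rewrite /order subset_leq_card // subsetT.
by have /= -> := congr1 val ak; rewrite FinRing.val_unitX.
Qed.

(** Once a translation has cleared position 0, every [ext0 tau] keeps it clear, and only the nonzero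
    positions remain for the PD-like set. *)
Lemma PD_like_locates (I : {set F}) (P : {set {perm {unit F}}}) s (e : word K F) :
  PD_like s (nonzero_part I) P -> (s < #|F|)%N -> (weight e <= s)%N ->
  exists2 sigma, sigma \in Sigma alpha & exists2 tau, tau \in P &
    {in I, forall g, perm_word (sigma * ext0 tau) e g = 0}.
Proof.
move=> PD lt_s we; have [sigma sS se0] := Sigma_clear0 (leq_ltn_trans we lt_s).
exists sigma => //; set e1 := perm_word sigma e in se0.
pose E0 := [set u : {unit F} | e1 (val u) != 0].
have le_E0 : (#|E0| <= s)%N.
  apply: leq_trans we; rewrite -(weight_perm sigma) -/e1.
  rewrite -(card_imset _ val_inj); apply/subset_leq_card/subsetP => _ /imsetP[u + ->].
  by rewrite !inE.
have le_sU : (s <= #|{: {unit F}}|)%N.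
  by rewrite -cardsT card_finField_unit -ltnS prednK // (leq_ltn_trans _ lt_s).
have [E sE cardE] := card_subset_extend le_E0 le_sU.
have [tau tauP dis] := PD E cardE; exists tau => // g gI.
rewrite -perm_wordM -/e1; have [->|nz] := eqVneq g 0.
  by rewrite -(ext0_0 tau) perm_word_perm.
have Ug : g \is a GRing.unit by rewrite unitfE.
pose u := FinRing.unit F Ug; pose w := (tau^-1)%g u.
have -> : g = ext0 tau (val w) by rewrite ext0_val permKV.
rewrite perm_word_perm; apply/eqP; apply: contraT => nzw.
have wE : w \in E by apply: (subsetP sE); rewrite inE.
have := disjointFr dis (imset_f tau wE).
by rewrite inE permKV gI.
Qed.

End ErrorLocation.

(** As [r1] divides [q ^ m - 1], the condition on [q ^ d] says that [q] has order [m] modulo [r1];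
    this makes the Vandermonde nodes distinct. *)
Theorem theorem10 (K F : finFieldType) (emb : {rmorphism K -> F})
    (q m n r1 r2 : nat) (hq : #|K| = q) (hF : #|F| = (q ^ m)%N)
    (hn : n = (q ^ m - 1)%N)
    (alpha : {unit F}) (halpha : generator [set: {unit F}] alpha)
    (hr : n = (r1 * r2)%N) (hcop : coprime r1 r2)
    (hr1 : (1 < r1)%N) (hr2 : (1 < r2)%N)
    (phi : {additive 'Z_n -> 'Z_r1 * 'Z_r2}) (hphi : bijective phi)
    (lambda0 s : nat) (hlambda0 : is_lambda0 m r1 lambda0)
    (hs : s = ((lambda0 + 1) * r2 - 1)%N) :
  let C := GRM1 emb m in
  let I := GammaInfoSet alpha m phi in
  let t := error_capability C in
  ((forall d, (0 < d < m)%N -> (q ^ d != 1 %[mod r1])%N) ->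
     information_set C I)
  /\
  (information_set C I ->
   (exists2 P : {set {perm {unit F}}},
      P \subset PAut (puncture C) & PD_like s (nonzero_part I) P)
   /\
   forall P : {set {perm {unit F}}},
     P \subset PAut (puncture C) -> PD_like s (nonzero_part I) P ->
   forall (r : nat) (H : 'M[K]_(r, #|F|)), std_parity_check C I H ->
   forall Ps : seq {perm {unit F}}, Ps =i P ->
   forall c e : word K F, c \in C ->
     (weight e <= t)%N -> (weight e <= s)%N ->
     algorithmI C I H alpha Ps (c + e) = Some c).
Proof.
move=> C I t; have [lt_ml l_gt0] := is_lambda0_ltn hlambda0.
have q_gt1 : (1 < q)%N by rewrite -hq finNzRing_gt1.
have n_gt3 : (3 < n)%N by rewrite hr; apply: (leq_mul hr1 hr2).
have m_gt0 : (0 < m)%N by case: (m) hn n_gt3 => // ->.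
have qm_gt0 : (0 < q ^ m)%N by rewrite expn_gt0 ltnW.
(* The only excluded case with [m] positive is [m = 1], [q = 2], where [n = 1]. *)
have nontrivial : (1 < m * (#|K| - 1))%N.
  rewrite hq; apply: contraLR n_gt3; rewrite -!leqNgt hn => le1.
  have [-> ->] : m = 1%N /\ q = 2%N by nia.
  by [].
have hF' : #|F| = (#|K| ^ m)%N by rewrite hq.
have lt_m : (m < r1)%N by apply: leq_ltn_trans lt_ml; rewrite leq_pmulr.
have n_gt1 : (1 < n)%N by rewrite ltnW // ltnW.
have card_units : #|F|.-1 = n by rewrite hF hn subn1.
have lt_s : (s < lambda0.+1 * r2)%N.
  by rewrite hs addn1 subn1 ltn_predL muln_gt0 (ltnW hr2).
pose beta := position alpha hphi (1, 0).
have IE : I = 0 |: [set val beta ^+ j | j : 'I_m].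
  exact: GammaInfoSetE.
split=> [ord_q|infoI].
  have beta_eq i j : (val beta ^+ i == val beta ^+ j) = (i == j %[mod r1])%N.
    rewrite -!FinRing.val_unitX (inj_eq val_inj).
    exact: position_beta_eq.
  apply: (@GRM1_information_set _ _ emb _ hF' nontrivial (val beta)).
  - have co_q : coprime r1 q.
      have r1_dvd : (r1 %| q ^ m - 1)%N by rewrite -hn hr dvdn_mulr.
      rewrite -(coprime_pexpr _ _ m_gt0) -(prednK qm_gt0) -subn1.
      by apply: coprime_dvdl r1_dvd _; apply: coprimenS.
    suff lt_neq i j : (i < j < m)%N -> val beta ^+ (q ^ i) != val beta ^+ (q ^ j).
      move=> i j /= eij; apply: val_inj; case: (ltngtP i j) => // lt_ij.
        by have := lt_neq i j; rewrite lt_ij ltn_ord -hq eij eqxx => /(_ isT).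
      by have := lt_neq j i; rewrite lt_ij ltn_ord -hq eij eqxx => /(_ isT).
    (* Equal nodes would mean that [r1] divides [q ^ i * (q ^ (j - i) - 1)]; the first factor is
       coprime to [r1], and [ord_q] rules out the second. *)
    move=> /andP[lt_ij lt_jm]; rewrite eq_sym beta_eq.
    rewrite eqn_mod_dvd; last by rewrite leq_exp2l // ltnW.
    rewrite -[j](subnKC (ltnW lt_ij)) expnD.
    rewrite -{2}[(q ^ i)%N]muln1 -mulnBr Gauss_dvdr ?coprimeXr //.
    rewrite -eqn_mod_dvd ?expn_gt0 ?(ltnW q_gt1) //.
    by rewrite ord_q // subn_gt0 lt_ij (leq_ltn_trans (leq_subr _ _)).
  - by rewrite IE setU11.
  - move=> j lt_j; rewrite IE inE; apply/orP; right.
    by apply/imsetP; exists (Ordinal lt_j).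
  - rewrite IE cardsU1 card_imset; last first.
      move=> i j /eqP; rewrite beta_eq !modn_small ?(ltn_trans (ltn_ord _) lt_m) //.
      by move=> /eqP/val_inj.
    rewrite card_ord (_ : 0 \notin _) //; apply/imsetP => -[j _ /esym/eqP].
    by rewrite expf_eq0 => /andP[_]; apply/negP; rewrite -unitfE (valP beta).
split=> [|P PC PD r H std Ps PsP c e cC we_t we_s].
  exists [set unit_mul v | v : {unit F}].
    by apply/subsetP => _ /imsetP[v _ ->]; apply: (GRM1_unit_mul _ hF' nontrivial).
  refine (shift_PD_like card_units halpha n_gt1 hr1 hr2 lt_ml lt_s _) => u.
  rewrite inE IE !inE => /orP[/eqP u0|/imsetP[j _ ej]].
    by have := valP u; rewrite /= u0 unitr0.
  by exists j => //; apply: val_inj; rewrite ej FinRing.val_unitX.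
rewrite /algorithmI; refine (algorithmI_along_correct infoI std _ _ cC we_t _).
- by move=> tau; rewrite PsP => /(subsetP PC); apply: GRM1_ext0.
- move=> sigma; rewrite inE => /predU1P[->|/mapP[k _ ->]].
    by apply: mem_PAut => x; rewrite perm_word1.
  exact: (GRM1_translation _ hF' nontrivial).
(* From [m * lambda0 < r1] follows [lambda0.+1 <= r1], hence [s < r1 * r2 = n]. *)
have lt_sF : (s < #|F|)%N.
  apply: (leq_trans lt_s); rewrite hF -(prednK qm_gt0) -subn1 -hn leqW // hr.
  rewrite leq_mul2r; apply/orP; right; apply: leq_trans lt_ml.
  by rewrite ltnS leq_pmull.
have [sigma sS [tau tauP e0]] := PD_like_locates halpha PD lt_sF we_s.
by exists sigma => //; exists tau; rewrite ?PsP.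
Qed.
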